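(* Let $A\in\mathbb{R}^{m\times n}$ be such that $Ae_j\neq cAe_i$ for all $i,j\in\{1,\dots,n\}$ with $i\neq j$ and all $c\in\mathbb{R}$. Let $P=A^\dagger A$ be the orthogonal projection onto $\mathcal{N}(A)^\perp$, and let $W\in\mathbb{R}^{n\times n}$ be the diagonal matrix with $We_i=\|Pe_i\|_2\,e_i$, $i=1,\dots,n$. Let $j\in\{1,\dots,n\}$ and let $\alpha$ satisfy $0<\alpha<[W^{-1}Pe_j]_j$. Then $x^*_\alpha=\gamma_{j,\alpha}\,e_j$, where $$\gamma_{j,\alpha}=1-\frac{\alpha}{[W^{-1}Pe_j]_j},$$ is the unique solution of $$\min_{x\in\mathbb{R}^n}\left\{\frac12\|Px-Pe_j\|_2^2+\alpha\|Wx\|_1\right\}.$$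
   Context: $e_1,\dots,e_n$ are the standard basis vectors of $\mathbb{R}^n$, $[v]_i$ denotes the $i$-th component of a vector $v$, $\|\cdot\|_1$ and $\|\cdot\|_2$ are the $\ell^1$- and Euclidean norms, $A^\dagger$ is the Moore-Penrose inverse of $A$, and $\mathcal{N}(A)$ is the null space of $A$. It is assumed, as part of the definition of $W$, that $Pe_i\neq 0$ for $i=1,\dots,n$ (so $W$ is invertible). *)

(* Defs.v *)
From HB Require Import structures.
From mathcomp Require Import all_boot all_order all_algebra.
From mathcomp Require Import reals.
Set Implicit Arguments.
Unset Strict Implicit.
Unset Printing Implicit Defensive.
Import Order.TTheory GRing.Theory Num.Theory.
Local Open Scope ring_scope.

Definition norm1 (R : realType) (n : nat) (x : 'cV[R]_n) : R :=
  \sum_(i < n) `|x i 0|.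

(* The library's norm on matrices is the sup norm, hence this definition. *)
Definition norm2 (R : realType) (n : nat) (x : 'cV[R]_n) : R :=
  Num.sqrt (\sum_(i < n) x i 0 ^+ 2).

Definition stdvec (R : realType) (n : nat) (i : 'I_n) : 'cV[R]_n :=
  delta_mx i 0.

Definition penrose (R : realType) (m n : nat) (A : 'M[R]_(m, n))
    (X : 'M[R]_(n, m)) : bool :=
  [&& A *m X *m A == A, X *m A *m X == X,
      (A *m X)^T == A *m X & (X *m A)^T == X *m A].

Lemma gram_unit (R : realType) (r n : nat) (F : 'M[R]_(r, n)) :
  row_free F -> F *m F^T \in unitmx.
Proof.
move=> freeF; rewrite -row_free_unit -kermx_eq0; apply/eqP/row_matrixP => i.
rewrite row0; set v := row i _.
have vG : v *m (F *m F^T) = 0 by rewrite -row_mul mulmx_ker row0.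
apply/eqP; rewrite -(mulmx_free_eq0 _ freeF); apply/eqP/rowP => k.
have /matrixP/(_ 0 0) : (v *m F) *m (v *m F)^T = 0.
  by rewrite trmx_mul mulmxA -(mulmxA v) vG mul0mx.
rewrite [LHS]mxE [RHS]mxE => /eqP.
rewrite psumr_eq0 => [/allP/(_ k (mem_index_enum _))|l _].
  by rewrite [_^T k 0]mxE -expr2 sqrf_eq0 => /eqP->; rewrite mxE.
by rewrite [_^T l 0]mxE -expr2 sqr_ge0.
Qed.

Lemma penrose_rank_factorization (R : realType) (m n r : nat)
    (C : 'M[R]_(m, r)) (F : 'M[R]_(r, n)) : row_full C -> row_free F ->
  penrose (C *m F)
    (F^T *m invmx (F *m F^T) *m (invmx (C^T *m C) *m C^T)).
Proof.
move=> fullC /gram_unit uF; set X := _ *m (_ *m _).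
have uC : C^T *m C \in unitmx.
  rewrite -[X in _ *m X]trmxK gram_unit //.
  by rewrite /row_free mxrank_tr; exact: fullC.
have AX : C *m F *m X = C *m invmx (C^T *m C) *m C^T.
  by rewrite /X !mulmxA -(mulmxA C F) mulmxK.
have XA : X *m (C *m F) = F^T *m invmx (F *m F^T) *m F.
  by rewrite /X -!mulmxA (mulmxA C^T) mulKmx.
have invT k (M : 'M[R]_k) : M^T = M -> (invmx M)^T = invmx M.
  by move=> MT; rewrite trmx_inv MT.
apply/and4P; split; apply/eqP.
- by rewrite AX -!mulmxA (mulmxA C^T) mulKmx.
- by rewrite XA /X !mulmxA -(mulmxA _ F) mulmxKV.
- by rewrite AX !trmx_mul trmxK invT ?mulmxA // trmx_mul trmxK.
- by rewrite XA !trmx_mul trmxK invT ?mulmxA // trmx_mul trmxK.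
Qed.

Lemma penrose_exists (R : realType) (m n : nat) (A : 'M[R]_(m, n)) :
  exists X, penrose A X.
Proof.
have := penrose_rank_factorization (col_base_full A) (row_base_free A).
by rewrite mulmx_base; eexists; eassumption.
Qed.

(* MathComp's pinvmx is only a one-sided partial inverse, not the Moore-Penrose
   inverse. The choice made here is irrelevant by penrose_unique below. *)
Definition mpinv (R : realType) (m n : nat) (A : 'M[R]_(m, n)) : 'M[R]_(n, m) :=
  xchoose (penrose_exists A).

Lemma penrose_mpinv (R : realType) (m n : nat) (A : 'M[R]_(m, n)) :
  penrose A (mpinv A).
Proof. exact: xchooseP. Qed.

Lemma penrose_unique (R : realType) (m n : nat) (A : 'M[R]_(m, n)) X Y :
  penrose A X -> penrose A Y -> X = Y.
Proof.
move=> /and4P[/eqP X1 /eqP X2 /eqP X3 /eqP X4].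
move=> /and4P[/eqP Y1 /eqP Y2 /eqP Y3 /eqP Y4].
have eL : A *m X = A *m Y.
  have : A *m Y *m (A *m X) = A *m X by rewrite mulmxA Y1.
  by move=> /(congr1 trmx); rewrite trmx_mul X3 Y3 mulmxA X1 => ->.
have eR : X *m A = Y *m A.
  have : X *m A *m (Y *m A) = X *m A by rewrite -mulmxA (mulmxA A) Y1.
  by move=> /(congr1 trmx); rewrite trmx_mul X4 Y4 -mulmxA (mulmxA A) X1 => ->.
by rewrite -X2 -mulmxA eL mulmxA eR Y2.
Qed.

Definition projP (R : realType) (m n : nat) (A : 'M[R]_(m, n)) : 'M[R]_n :=
  mpinv A *m A.

Definition weightW (R : realType) (m n : nat) (A : 'M[R]_(m, n)) : 'M[R]_n :=
  diag_mx (\row_(i < n) norm2 (projP A *m stdvec R i)).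

Definition unique_minimizer (R : realType) (T : Type) (f : T -> R) (x : T) : Prop :=
  (forall y, f x <= f y) /\
  (forall z, (forall y, f z <= f y) -> z = x).

(* Main.v *)
Require Import Defs.
From mathcomp Require Import all_boot all_order all_algebra.
From mathcomp Require Import reals.
From mathcomp Require Import ring.
Set Implicit Arguments.
Unset Strict Implicit.
Unset Printing Implicit Defensive.
Import Order.TTheory GRing.Theory Num.Theory.
Local Open Scope ring_scope.

(** Write [w i] for the norm of [P e_i]. As [P] is an orthogonal projection,
    [<P e_i, P e_j> = P i j] and in particular [P j j = w j ^+ 2]; hence
    [(W^-1 P e_j)_j = w j] and the candidate is [g e_j] with
    [g = 1 - alpha / w j]. The residual of the candidate is
    [- (alpha / w j) P e_j], so expanding the square around it gives, for
    every [y], the exact value of the excess ([lasso_excess]):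

      [f y - f (g e_j) = |P (y - g e_j)|^2 / 2
                         + alpha * \sum_i (w i |y i| - P i j * y i / w j)].

    Cauchy-Schwarz makes each summand nonnegative, so [g e_j] is a minimizer.
    No two columns of [A] being parallel, no two vectors [P e_i], [P e_j] are
    parallel either (apply [A], using [A P = A]); Cauchy-Schwarz is then strict
    and a summand with [i != j] vanishes only if [y i = 0]. A minimizer is
    therefore a multiple of [e_j], and the quadratic term fixes the multiple
    because [P e_j <> 0]. *)

(** * Euclidean inner product *)

Definition dotv (R : realType) (n : nat) (x y : 'cV[R]_n) : R :=
  \sum_(i < n) x i 0 * y i 0.

Section Dot.
Variables (R : realType) (n : nat).
Implicit Types x y z : 'cV[R]_n.

Lemma dotvC x y : dotv x y = dotv y x.
Proof. by apply: eq_bigr => i _; rewrite mulrC. Qed.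

Lemma dotvBl x y z : dotv (x - y) z = dotv x z - dotv y z.
Proof. by rewrite -sumrB; apply: eq_bigr => i _; rewrite !mxE mulrBl. Qed.

Lemma dotvZl c x y : dotv (c *: x) y = c * dotv x y.
Proof. by rewrite mulr_sumr; apply: eq_bigr => i _; rewrite !mxE mulrA. Qed.

Lemma dotv_stdvec x i : dotv (stdvec R i) x = x i 0.
Proof.
rewrite /dotv (bigD1 i) //= big1 ?mxE ?eqxx ?mul1r ?addr0 // => k /negPf ki.
by rewrite mxE ki mul0r.
Qed.

Lemma dotvMl (M : 'M[R]_n) x y : dotv (M *m x) y = dotv x (M^T *m y).
Proof.
have dotE u v : dotv u v = (u^T *m v) 0 0.
  by rewrite mxE; apply: eq_bigr => i _; rewrite mxE.
by rewrite !dotE trmx_mul mulmxA.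
Qed.

Lemma norm2_ge0 x : 0 <= norm2 x.
Proof. exact: sqrtr_ge0. Qed.

Lemma sqr_norm2 x : norm2 x ^+ 2 = dotv x x.
Proof.
rewrite sqr_sqrtr; last by apply: sumr_ge0 => i _; exact: sqr_ge0.
by apply: eq_bigr => i _; rewrite expr2.
Qed.

Lemma norm2_eq0 x : (norm2 x == 0) = (x == 0).
Proof.
rewrite -sqrf_eq0 sqr_norm2 psumr_eq0 => [|i _]; last by rewrite -expr2 sqr_ge0.
apply/allP/eqP => [h|-> i _]; last by rewrite mxE mul0r /= eqxx.
apply/colP => i; have := h i (mem_index_enum _).
by rewrite -expr2 sqrf_eq0 mxE => /eqP.
Qed.

Lemma norm2_gt0 x : x <> 0 -> 0 < norm2 x.
Proof. by move=> /eqP x0; rewrite lt0r norm2_eq0 x0 norm2_ge0. Qed.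

Lemma sqr_norm2BZ c x y :
  norm2 (x - c *: y) ^+ 2
  = norm2 x ^+ 2 - 2 * c * dotv x y + c ^+ 2 * norm2 y ^+ 2.
Proof.
rewrite !sqr_norm2 dotvBl dotvZl (dotvC x) (dotvC y (_ - _)) !dotvBl !dotvZl.
by rewrite (dotvC y x); ring.
Qed.

(** [x] minus its projection onto the line of [y] is nonzero, and the square of
    its norm is [|x|^2 - <x, y>^2 / |y|^2]. *)
Lemma strict_cauchy_schwarz x y :
  y <> 0 -> (forall c, x <> c *: y) -> `|dotv x y| < norm2 x * norm2 y.
Proof.
move=> y0 xy; have ny := norm2_gt0 y0.
set c := dotv x y / norm2 y ^+ 2.
have: 0 < norm2 (x - c *: y) ^+ 2.
  by rewrite exprn_gt0 // norm2_gt0 // => /eqP; rewrite subr_eq0 => /eqP/xy.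
rewrite sqr_norm2BZ => pos.
rewrite -(ltr_pXn2r (n := 2)) ?nnegrE ?mulr_ge0 ?norm2_ge0 //.
rewrite real_normK ?num_real //.
rewrite -subr_gt0 exprMn.
suff -> : norm2 x ^+ 2 * norm2 y ^+ 2 - dotv x y ^+ 2 =
   norm2 y ^+ 2 * (norm2 x ^+ 2 - 2 * c * dotv x y + c ^+ 2 * norm2 y ^+ 2).
  by rewrite mulr_gt0 ?exprn_gt0.
by rewrite /c; field; rewrite lt0r_neq0.
Qed.

End Dot.

(** * The projection and its columns *)

Section Projection.
Variables (R : realType) (m n : nat) (A : 'M[R]_(m, n)).

Lemma projP_sym : (projP A)^T = projP A.
Proof. by have /and4P[_ _ _ /eqP] := penrose_mpinv A. Qed.

Lemma projP_idem : projP A *m projP A = projP A.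
Proof.
by have /and4P[_ /eqP XAX _ _] := penrose_mpinv A; rewrite /projP mulmxA XAX.
Qed.

Lemma mulmx_projP : A *m projP A = A.
Proof. by have /and4P[/eqP AXA _ _ _] := penrose_mpinv A; rewrite mulmxA. Qed.

Lemma dotv_projP x y :
  dotv (projP A *m x) (projP A *m y) = dotv x (projP A *m y).
Proof. by rewrite dotvMl projP_sym mulmxA projP_idem. Qed.

Lemma dotv_projP_stdvec i j :
  dotv (projP A *m stdvec R i) (projP A *m stdvec R j)
  = (projP A *m stdvec R j) i 0.
Proof. by rewrite dotv_projP dotv_stdvec. Qed.

Lemma projP_stdvec_diag j :
  (projP A *m stdvec R j) j 0 = norm2 (projP A *m stdvec R j) ^+ 2.
Proof. by rewrite sqr_norm2 dotv_projP_stdvec. Qed.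

(** A dependence between [P e_i] and [P e_j] would pass to the columns of [A]
    because [A P = A], so Cauchy-Schwarz is strict here. *)
Lemma projP_stdvec_lt i j :
  projP A *m stdvec R j <> 0 ->
  (forall c, A *m stdvec R i <> c *: (A *m stdvec R j)) ->
  `|(projP A *m stdvec R j) i 0|
  < norm2 (projP A *m stdvec R i) * norm2 (projP A *m stdvec R j).
Proof.
move=> Pj0 hA; rewrite -dotv_projP_stdvec; apply: strict_cauchy_schwarz => // c.
move=> /(congr1 (mulmx A)).
rewrite -scalemxAr !(mulmxA A (projP A)) mulmx_projP.
exact: hA.
Qed.

Lemma weightW_entry (x : 'cV[R]_n) i :
  (weightW A *m x) i 0 = norm2 (projP A *m stdvec R i) * x i 0.
Proof. by rewrite mul_diag_mx !mxE. Qed.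

Lemma invmx_weightW_entry (x : 'cV[R]_n) i :
  (forall k, projP A *m stdvec R k <> 0) ->
  (invmx (weightW A) *m x) i 0 = x i 0 / norm2 (projP A *m stdvec R i).
Proof.
move=> hP.
have uW : weightW A \in unitmx.
  rewrite unitmxE det_diag unitfE; apply/prodf_neq0 => k _.
  by rewrite mxE lt0r_neq0 // norm2_gt0.
rewrite -{2}(mulKVmx uW x) weightW_entry mulrC mulKf //.
by rewrite lt0r_neq0 // norm2_gt0.
Qed.

Lemma norm1_weightW x :
  norm1 (weightW A *m x)
  = \sum_(i < n) norm2 (projP A *m stdvec R i) * `|x i 0|.
Proof.
by apply: eq_bigr => i _; rewrite weightW_entry normrM ger0_norm ?norm2_ge0.
Qed.

(** * The objective around the candidate *)

(** The duality gap of the weighted l1 norm at coordinate [i], against the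
    vector [P e_j / |P e_j|], which is the residual of the candidate divided
    by [alpha], up to sign. *)
Definition l1_gap j (x : 'cV[R]_n) i : R :=
  norm2 (projP A *m stdvec R i) * `|x i 0|
  - (projP A *m stdvec R j) i 0 * x i 0 / norm2 (projP A *m stdvec R j).

Lemma sum_l1_gap j x :
  \sum_(i < n) l1_gap j x i
  = norm1 (weightW A *m x)
    - dotv x (projP A *m stdvec R j) / norm2 (projP A *m stdvec R j).
Proof.
rewrite norm1_weightW sumrB mulr_suml; congr (_ - _).
by apply: eq_bigr => i _; congr (_ / _); rewrite mulrC.
Qed.

Definition lasso j (alpha : R) (x : 'cV[R]_n) : R :=
  2^-1 * norm2 (projP A *m x - projP A *m stdvec R j) ^+ 2
  + alpha * norm1 (weightW A *m x).

(** The first-order terms cancel at coordinate [j] because [0 <= g] and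
    [P j j = |P e_j|^2]; what remains of them is the duality gap. *)
Lemma lasso_excess j alpha g y :
  projP A *m stdvec R j <> 0 ->
  g = 1 - alpha / norm2 (projP A *m stdvec R j) -> 0 <= g ->
  lasso j alpha y
  = lasso j alpha (g *: stdvec R j)
    + 2^-1 * norm2 (projP A *m (y - g *: stdvec R j)) ^+ 2
    + alpha * \sum_(i < n) l1_gap j y i.
Proof.
move=> /norm2_gt0 + gE g0; rewrite sum_l1_gap /lasso.
set a := projP A *m _; set w := norm2 a => w0.
have residual x :
    projP A *m x - a = projP A *m (x - g *: stdvec R j) - (alpha / w) *: a.
  rewrite mulmxBr -scalemxAr -/a gE scalerBl scale1r.
  by rewrite opprB addrA (addrAC _ (- a)) addrK.
have norm1g : norm1 (weightW A *m (g *: stdvec R j)) = w * g.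
  rewrite norm1_weightW (bigD1 j) //= big1 => [|i /negPf ij].
    by rewrite !mxE !eqxx mulr1 addr0 ger0_norm.
  by rewrite !mxE ij mulr0 normr0 mulr0.
have dotPh : dotv (projP A *m (y - g *: stdvec R j)) a = dotv y a - g * w ^+ 2.
  rewrite dotv_projP -/a dotvBl dotvZl dotv_stdvec.
  by rewrite projP_stdvec_diag.
rewrite (residual y) (residual (g *: _)) subrr mulmx0 !sqr_norm2BZ dotPh norm1g.
have -> : dotv 0 a = 0 by rewrite -(scale0r a) dotvZl mul0r.
have -> : norm2 (0 : 'cV[R]_n) = 0 by apply/eqP; rewrite norm2_eq0.
by rewrite -/w; field; rewrite lt0r_neq0.
Qed.

Lemma l1_gap_gt0 j (x : 'cV[R]_n) i :
  projP A *m stdvec R j <> 0 ->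
  (forall c, A *m stdvec R i <> c *: (A *m stdvec R j)) ->
  x i 0 != 0 -> 0 < l1_gap j x i.
Proof.
move=> Pj0 hA xi0; rewrite subr_gt0 ltr_pdivrMr ?norm2_gt0 //.
apply: le_lt_trans (ler_norm _) _; rewrite normrM mulrAC.
by rewrite ltr_pM2r ?normr_gt0 // projP_stdvec_lt.
Qed.

Lemma l1_gap_diag_ge0 j (x : 'cV[R]_n) :
  projP A *m stdvec R j <> 0 -> 0 <= l1_gap j x j.
Proof.
move=> /norm2_gt0 w0; rewrite /l1_gap projP_stdvec_diag expr2 mulrAC mulfK.
  by rewrite -mulrBr mulr_ge0 ?norm2_ge0 // subr_ge0 ler_norm.
by rewrite lt0r_neq0.
Qed.

End Projection.

Theorem theorem4p3 (R : realType) (m n : nat) (A : 'M[R]_(m, n))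
    (hA : forall (i j : 'I_n) (c : R), i <> j ->
       A *m stdvec R j <> c *: (A *m stdvec R i))
    (hP : forall i : 'I_n, projP A *m stdvec R i <> 0)
    (j : 'I_n) (alpha : R) (halpha0 : 0 < alpha)
    (halpha1 : alpha < (invmx (weightW A) *m projP A *m stdvec R j) j 0) :
  let P := projP A in
  let W := weightW A in
  let gamma := 1 - alpha / (invmx W *m P *m stdvec R j) j 0 in
  unique_minimizer
    (fun x : 'cV[R]_n =>
       2^-1 * norm2 (P *m x - P *m stdvec R j) ^+ 2 + alpha * norm1 (W *m x))
    (gamma *: stdvec R j).
Proof.
move=> P W; set w := (_ *m _) j 0 => g.
have w0 : 0 < norm2 (P *m stdvec R j) by exact: norm2_gt0.
have wE : w = norm2 (P *m stdvec R j).
  rewrite /w -mulmxA invmx_weightW_entry // projP_stdvec_diag.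
  by rewrite expr2 mulfK // lt0r_neq0.
have g0 : 0 <= g.
  by rewrite subr_ge0 ler_pdivrMr ?wE // mul1r -wE ltW.
have gE : g = 1 - alpha / norm2 (P *m stdvec R j) by rewrite /g wE.
have excess y := lasso_excess y (hP j) gE g0.
have gap_gt0 (y : 'cV[R]_n) i : i != j -> y i 0 != 0 -> 0 < l1_gap A j y i.
  by move=> /eqP ij; apply: l1_gap_gt0 => // c; apply: hA => /esym.
have gap_ge0 (y : 'cV[R]_n) i : 0 <= l1_gap A j y i.
  have [->|ij] := eqVneq i j; first exact: l1_gap_diag_ge0.
  have [yi0|yi0] := eqVneq (y i 0) 0; last exact/ltW/gap_gt0.
  by rewrite /l1_gap yi0 normr0 !mulr0 mul0r subrr.
have gaps_ge0 (y : 'cV[R]_n) : 0 <= alpha * \sum_i l1_gap A j y i.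
  by rewrite mulr_ge0 ?sumr_ge0 // ltW.
have quad_ge0 y : 0 <= 2^-1 * norm2 (P *m (y - g *: stdvec R j)) ^+ 2.
  by rewrite mulr_ge0 ?invr_ge0 ?sqr_ge0.
change (unique_minimizer (lasso A j alpha) (g *: stdvec R j)).
split=> [y|z /(_ (g *: stdvec R j))].
  by rewrite (excess y) -addrA lerDl addr_ge0.
rewrite (excess z) -addrA gerDl => le0.
have /andP[] : (2^-1 * norm2 (P *m (z - g *: stdvec R j)) ^+ 2 == 0)
               && (alpha * \sum_i l1_gap A j z i == 0).
  by rewrite -paddr_eq0 // eq_le le0 addr_ge0.
rewrite mulf_eq0 invr_eq0 pnatr_eq0 /= sqrf_eq0 norm2_eq0 => /eqP Ph0.
rewrite mulf_eq0 gt_eqF //= psumr_eq0 // => /allP gap0.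
have zE : z = z j 0 *: stdvec R j.
  apply/colP => i; rewrite !mxE andbT.
  have [->|ij] := eqVneq i j; first by rewrite mulr1.
  rewrite mulr0; apply/eqP; apply: contraT => zi0.
  by have := gap_gt0 _ _ ij zi0; rewrite (eqP (gap0 i (mem_index_enum _))) ltxx.
move: Ph0; rewrite zE -scalerBl -scalemxAr => /eqP.
rewrite scaler_eq0 subr_eq0 => /orP[/eqP-> //|/eqP/hP []].
Qed.
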